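(* Let $J,R,Q\in\mathbb{C}^{n,n}$ with $J^*=-J$, $R^*=R\ge 0$ and $Q^*=Q>0$, and suppose that the dissipative Hamiltonian system $\dot x=(J-R)Qx$ is asymptotically stable. Let $V^*RV=D$ be the spectral decomposition of $R$, where $V\in\mathbb{C}^{n,n}$ is unitary and $D=\mathrm{diag}(d_1,\dots,d_n)$ with $d_1\ge d_2\ge\dots\ge d_n\ge 0$. Then $$d_n^2+\inf_{\omega\in\mathbb{R}}\lambda_{\min}\!\left(Q^{-1}(i\omega I_n-JQ)^*(i\omega I_n-JQ)Q^{-1}\right)\ \le\ r^{S_d}(J,R)^2\ \le\ d_n^2+\inf_{\omega\in\mathbb{R}}\frac{\|(i\omega I_n-JQ)\hat x\|^2}{\|Q\hat x\|^2},$$ where $\hat x=Q^{-1}Ve_n$ and $e_n$ is the $n$th column of the $n\times n$ identity matrix.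
   Context: $\mathbb{C}^{n,n}$ is the set of complex $n\times n$ matrices; $\|\cdot\|$ is the spectral norm of a matrix (and the Euclidean norm of a vector); $\Lambda(A)$ is the spectrum of $A$; $\lambda_{\min}$ denotes the smallest eigenvalue of a Hermitian matrix; $A\ge 0$, $A\le 0$, $A>0$ mean that $A$ is Hermitian and positive semidefinite, negative semidefinite, positive definite, respectively. The system $\dot x=(J-R)Qx$ is asymptotically stable if all eigenvalues of $(J-R)Q$ lie in the open left half plane. For $(\Delta_J,\Delta_R)\in(\mathbb{C}^{n,n})^2$ put $|||(\Delta_J,\Delta_R)|||=\sqrt{\|\Delta_J\|^2+\|\Delta_R\|^2}$. The perturbation set is $$S_d(J,R)=\{(\Delta_J,\Delta_R)\in(\mathbb{C}^{n,n})^2:\ \Delta_J^*=-\Delta_J,\ \Delta_R^*=\Delta_R\le 0,\ R+\Delta_R\ge 0\},$$ and the structured stability radius is $$r^{S_d}(J,R)=\inf\{|||(\Delta_J,\Delta_R)|||:\ (\Delta_J,\Delta_R)\in S_d(J,R),\ \Lambda((J+\Delta_J-(R+\Delta_R))Q)\cap i\mathbb{R}\neq\emptyset\}.$$ *)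

(* Defs.v *)
From HB Require Import structures.
From mathcomp Require Import all_boot all_order all_algebra.
From mathcomp Require Import sesquilinear spectral.
From mathcomp.real_closed Require Import complex.
From mathcomp Require Import boolp classical_sets reals constructive_ereal ereal.

Set Implicit Arguments.
Unset Strict Implicit.
Unset Printing Implicit Defensive.

Import Order.TTheory GRing.Theory Num.Theory.
Local Open Scope classical_set_scope.
Local Open Scope ring_scope.
Local Open Scope complex_scope.
Local Open Scope sesquilinear_scope.

(* The real field is an arbitrary [realType] K, and the complex field is K[i].
   In K[i], [0 <= z] means that z is real and nonnegative. *)

Definition vec_norm (K : realType) (n : nat) (x : 'cV[K[i]]_n) : K :=
  Num.sqrt (\sum_i Normc.normc (x i 0) ^+ 2).

Definition spectral_norm (K : realType) (m n : nat) (A : 'M[K[i]]_(m, n)) : K :=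
  sup [set vec_norm (A *m x) | x in [set x : 'cV[K[i]]_n | vec_norm x = 1]].

Definition hermitian (K : realType) (n : nat) (A : 'M[K[i]]_n) : Prop :=
  A^t* = A.

Definition skew_hermitian (K : realType) (n : nat) (A : 'M[K[i]]_n) : Prop :=
  A^t* = - A.

Definition possemidef (K : realType) (n : nat) (A : 'M[K[i]]_n) : Prop :=
  hermitian A /\ forall x : 'cV[K[i]]_n, 0 <= (x^t* *m A *m x) 0 0.

Definition negsemidef (K : realType) (n : nat) (A : 'M[K[i]]_n) : Prop :=
  hermitian A /\ forall x : 'cV[K[i]]_n, (x^t* *m A *m x) 0 0 <= 0.

Definition posdef (K : realType) (n : nat) (A : 'M[K[i]]_n) : Prop :=
  hermitian A /\
  forall x : 'cV[K[i]]_n, x != 0 -> 0 < (x^t* *m A *m x) 0 0.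

(* [eigenvalue] is defined through row eigenvectors; the resulting spectrum is
   the same as with column eigenvectors ([eigenvalue_root_char]). *)
Definition spectrum (K : realType) (n : nat) (A : 'M[K[i]]_n) : set K[i] :=
  [set z | eigenvalue A z].

Definition imaginary_axis (K : realType) : set K[i] :=
  [set z | complex.Re z = 0].

Definition asymptotically_stable (K : realType) (n : nat) (A : 'M[K[i]]_n) :
    Prop :=
  forall z : K[i], spectrum A z -> complex.Re z < 0.

(* Meant for Hermitian A of size at least 1: the set below is then finite and
   nonempty, and its infimum is a minimum. *)
Definition lambda_min (K : realType) (n : nat) (A : 'M[K[i]]_n) : K :=
  inf [set a : K | spectrum A a%:C].

Definition pair_norm (K : realType) (n : nat)
    (D : 'M[K[i]]_n * 'M[K[i]]_n) : K :=
  Num.sqrt (spectral_norm D.1 ^+ 2 + spectral_norm D.2 ^+ 2).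

(* The set S_d(J, R), whose elements are pairs (Delta_J, Delta_R); its
   defining conditions do not involve J. *)
Definition Sd (K : realType) (n : nat) (J R : 'M[K[i]]_n) :
    set ('M[K[i]]_n * 'M[K[i]]_n) :=
  [set D | [/\ skew_hermitian D.1, negsemidef D.2 & possemidef (R + D.2)]].

(* The radius depends also on Q, which the notation r^{S_d}(J, R) leaves
   implicit. *)
Definition radius_Sd (K : realType) (n : nat) (J R Q : 'M[K[i]]_n) : \bar K :=
  ereal_inf [set (pair_norm D)%:E | D in
    [set D | Sd J R D /\
       spectrum ((J + D.1 - (R + D.2)) *m Q) `&` @imaginary_axis K !=set0]].

(* Main.v *)
(* Put S(w) = (i w - J Q) Q^-1 = i w Q^-1 - J, which is skew-hermitian.  If
   (DJ, DR) moves an eigenvalue to i w, then S(w) y = (DJ - (R + DR)) y for some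
   unit vector y.  Skew-hermitian forms are imaginary, so y^* (R + DR) y = 0,
   hence (R + DR) y = 0 by semidefiniteness, S(w) y = DJ y and R y = - DR y;
   thus |DJ|^2 >= lambda_min(S^* S) and |DR| >= d_n.
   Conversely, for y = V e_n take DR = - d_n y y^* and for DJ the number i times
   a scaled Householder reflection mapping y to -i S(w) y, which is hermitian
   because y^* S(w) y is imaginary; then |DJ| = |S(w) y|. *)
Require Import Defs.
From HB Require Import structures.
From mathcomp Require Import all_boot all_order all_algebra.
From mathcomp Require Import sesquilinear spectral.
From mathcomp.real_closed Require Import complex.
From mathcomp Require Import boolp classical_sets reals constructive_ereal ereal.
From mathcomp Require Import ring lra.

Set Implicit Arguments.
Unset Strict Implicit.
Unset Printing Implicit Defensive.

Import Order.TTheory GRing.Theory Num.Theory.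
Local Open Scope classical_set_scope.
Local Open Scope ring_scope.
Local Open Scope complex_scope.
Local Open Scope sesquilinear_scope.

Section ComplexMatrices.
Context {K : realType}.
Implicit Types m n p : nat.

(** * Conjugate transposes and the standard inner product *)

Lemma adjmxM m n p (A : 'M[K[i]]_(m, n)) (B : 'M[K[i]]_(n, p)) :
  (A *m B)^t* = B^t* *m A^t*.
Proof. by rewrite trmx_mul map_mxM. Qed.

Lemma adjmxD m n (A B : 'M[K[i]]_(m, n)) : (A + B)^t* = A^t* + B^t*.
Proof. by rewrite linearD /= map_mxD. Qed.

Lemma adjmxN m n (A : 'M[K[i]]_(m, n)) : (- A)^t* = - A^t*.
Proof. by rewrite linearN /= map_mxN. Qed.

Lemma adjmxZ m n a (A : 'M[K[i]]_(m, n)) : (a *: A)^t* = Num.conj a *: A^t*.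
Proof. by rewrite linearZ /= map_mxZ. Qed.

Lemma adj_scalar_mx n (a : K[i]) : (a%:M : 'M_n)^t* = (Num.conj a)%:M.
Proof. by rewrite tr_scalar_mx map_scalar_mx. Qed.

Lemma adj_invmx n (A : 'M[K[i]]_n) : (invmx A)^t* = invmx (A^t*).
Proof. by rewrite trmx_inv map_invmx. Qed.

Lemma adjmx_eq0 m n (A : 'M[K[i]]_(m, n)) : (A^t* == 0) = (A == 0).
Proof.
apply/eqP/eqP => [A0|->]; last by rewrite trmx0 map_mx0.
by rewrite -[A]trmxCK A0 trmx0 map_mx0.
Qed.

Definition dotC n (x y : 'cV[K[i]]_n) : K[i] := (x^t* *m y) 0 0.

Lemma dotC_mulmx n (x y : 'cV[K[i]]_n) : x^t* *m y = (dotC x y)%:M.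
Proof. by rewrite [LHS]mx11_scalar. Qed.

Lemma dotCJ n (x y : 'cV[K[i]]_n) : Num.conj (dotC x y) = dotC y x.
Proof.
have <- : ((x^t* *m y)^t*) 0 0 = dotC y x by rewrite adjmxM trmxCK.
by rewrite [RHS]mxE [in RHS]mxE.
Qed.

Lemma dotCDr n (x y z : 'cV[K[i]]_n) : dotC x (y + z) = dotC x y + dotC x z.
Proof. by rewrite /dotC mulmxDr mxE. Qed.

Lemma dotCNr n (x y : 'cV[K[i]]_n) : dotC x (- y) = - dotC x y.
Proof. by rewrite /dotC mulmxN mxE. Qed.

Lemma dotCZr n a (x y : 'cV[K[i]]_n) : dotC x (a *: y) = a * dotC x y.
Proof. by rewrite /dotC -scalemxAr mxE. Qed.

Lemma dotCDl n (x y z : 'cV[K[i]]_n) : dotC (x + y) z = dotC x z + dotC y z.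
Proof. by rewrite /dotC adjmxD mulmxDl mxE. Qed.

Lemma dotCNl n (x y : 'cV[K[i]]_n) : dotC (- x) y = - dotC x y.
Proof. by rewrite /dotC adjmxN mulNmx mxE. Qed.

Lemma dotCZl n a (x y : 'cV[K[i]]_n) : dotC (a *: x) y = Num.conj a * dotC x y.
Proof. by rewrite /dotC adjmxZ -scalemxAl mxE. Qed.

Lemma dotC_adjl m n (A : 'M[K[i]]_(m, n)) x y :
  dotC (A *m x) y = dotC x (A^t* *m y).
Proof. by rewrite /dotC adjmxM mulmxA. Qed.

Lemma dotC_adjr m n (A : 'M[K[i]]_(m, n)) x y :
  dotC x (A *m y) = dotC (A^t* *m x) y.
Proof. by rewrite dotC_adjl trmxCK. Qed.

Lemma mul_rank1 n (u v x : 'cV[K[i]]_n) : u *m v^t* *m x = dotC v x *: u.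
Proof. by rewrite -mulmxA dotC_mulmx mul_mx_scalar. Qed.

(** * The Euclidean norm of a vector *)

Lemma normc_ge0 (z : K[i]) : 0 <= Normc.normc z.
Proof. by case: z => ? ?; exact: sqrtr_ge0. Qed.

Lemma vec_norm_ge0 n (x : 'cV[K[i]]_n) : 0 <= vec_norm x.
Proof. exact: sqrtr_ge0. Qed.

Lemma sqr_vec_norm n (x : 'cV[K[i]]_n) :
  vec_norm x ^+ 2 = \sum_i Normc.normc (x i 0) ^+ 2.
Proof. by rewrite sqr_sqrtr // sumr_ge0 // => i _; rewrite sqr_ge0. Qed.

Lemma dotCE n (x : 'cV[K[i]]_n) : dotC x x = (vec_norm x ^+ 2)%:C.
Proof.
rewrite sqr_vec_norm rmorph_sum /dotC mxE; apply: eq_bigr => i _.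
rewrite 2!mxE rmorphXn /= mulrC -normCK; congr (_ ^+ 2).
Qed.

Lemma vec_norm_dotC n p (x : 'cV[K[i]]_n) (y : 'cV[K[i]]_p) :
  dotC x x = dotC y y -> vec_norm x = vec_norm y.
Proof.
rewrite !dotCE => /complexI /eqP.
by rewrite eqrXn2 ?vec_norm_ge0 // => /eqP.
Qed.

Lemma dotC_ge0 n (x : 'cV[K[i]]_n) : 0 <= dotC x x.
Proof. by rewrite dotCE ler0c sqr_ge0. Qed.

Lemma vec_normZ n a (x : 'cV[K[i]]_n) :
  vec_norm (a *: x) = Normc.normc a * vec_norm x.
Proof.
apply/eqP; rewrite -(@eqrXn2 _ 2) ?mulr_ge0 ?normc_ge0 ?vec_norm_ge0 //.
rewrite exprMn !sqr_vec_norm mulr_sumr; apply/eqP/eq_bigr => i _.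
by rewrite mxE Normc.normcM exprMn.
Qed.

Lemma vec_norm_eq0 n (x : 'cV[K[i]]_n) : vec_norm x = 0 -> x = 0.
Proof.
move=> x0; have /eqP : vec_norm x ^+ 2 = 0 by rewrite x0 expr0n.
rewrite sqr_vec_norm psumr_eq0; last by move=> i _; rewrite sqr_ge0.
move=> /allP xi0; apply/matrixP => i j; rewrite (ord1 j) mxE.
have := xi0 i; rewrite mem_index_enum => /(_ isT); rewrite sqrf_eq0.
by move=> /eqP /Normc.eq0_normc.
Qed.

Lemma dotC_eq0 n (x : 'cV[K[i]]_n) : dotC x x = 0 -> x = 0.
Proof.
rewrite dotCE => /(@complexI _ _ 0) /eqP; rewrite sqrf_eq0 => /eqP.
exact: vec_norm_eq0.
Qed.

Lemma vec_norm_normalize n (x : 'cV[K[i]]_n) :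
  x != 0 -> vec_norm ((vec_norm x)^-1%:C *: x) = 1.
Proof.
move=> x0; rewrite vec_normZ /= expr0n addr0 sqrtr_sqr.
have nx0 : vec_norm x != 0 by apply: contra_neq x0; exact: vec_norm_eq0.
by rewrite ger0_norm ?invr_ge0 ?vec_norm_ge0 // mulVf.
Qed.

(** * The spectral norm and the Cauchy-Schwarz inequality *)

(** Each entry of a unit vector has modulus at most 1, so every entry of [A *m x] is bounded by the
    absolute sum of the corresponding row of [A]. Boundedness makes the [sup] in [spectral_norm] a
    genuine supremum. *)
Lemma has_ubound_spectral_norm m n (A : 'M[K[i]]_(m, n)) :
  has_ubound [set vec_norm (A *m x) | x in [set x : 'cV_n | vec_norm x = 1]].
Proof.
pose B := \sum_i (\sum_j Normc.normc (A i j)) ^+ 2.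
exists (Num.sqrt B) => _ [x /= x1 <-].
rewrite ler_wsqrtr //; apply: ler_sum => i _.
rewrite ler_pXn2r ?nnegrE ?sumr_ge0 ?normc_ge0 // => [|j _]; last first.
  exact: normc_ge0.
rewrite mxE; apply: (le_trans (y := \sum_j Normc.normc (A i j * x j 0))).
  elim/big_ind2 : _ => //; first by rewrite Normc.normc0.
  by move=> a b c e ab ce; apply: le_trans (lerD ab ce); exact: le_normcD.
apply: ler_sum => j _; rewrite Normc.normcM ler_piMr ?normc_ge0 //.
rewrite -(@ler_pXn2r _ 2) ?nnegrE ?normc_ge0 // expr1n.
have <- : vec_norm x ^+ 2 = 1 by rewrite x1 expr1n.
rewrite sqr_vec_norm (bigD1 j) //= lerDl sumr_ge0 // => k _.
by rewrite sqr_ge0.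
Qed.

Lemma spectral_norm_ge m n (A : 'M[K[i]]_(m, n)) x :
  vec_norm x = 1 -> vec_norm (A *m x) <= spectral_norm A.
Proof.
by move=> x1; apply: ub_le_sup; [exact: has_ubound_spectral_norm | exists x].
Qed.

(** The norms of both constructed perturbations are computed this way, each with the eigenvector of
    [R] as maximizer. *)
Lemma spectral_norm_eq m n (A : 'M[K[i]]_(m, n)) x :
  vec_norm x = 1 ->
  (forall z, vec_norm z = 1 -> vec_norm (A *m z) <= vec_norm (A *m x)) ->
  spectral_norm A = vec_norm (A *m x).
Proof.
move=> x1 Amax; apply/eqP; rewrite eq_le spectral_norm_ge // andbT.
by apply: ge_sup => [|_ [z z1 <-]]; [exists (vec_norm (A *m x)), x|exact: Amax].
Qed.

(** Cauchy-Schwarz, read off from the nonnegative squared norm of [z] minus its projection onto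
    [y]. *)
Lemma normc_dotC_le n (y z : 'cV[K[i]]_n) :
  vec_norm y = 1 -> Normc.normc (dotC y z) <= vec_norm z.
Proof.
move=> y1; rewrite -(@ler_pXn2r _ 2) ?nnegrE ?normc_ge0 ?vec_norm_ge0 //.
have yy : dotC y y = 1 by rewrite dotCE y1 expr1n.
have := dotC_ge0 (z - dotC y z *: y).
rewrite !(dotCDr, dotCDl, dotCNr, dotCNl, dotCZl, dotCZr) yy mulr1 dotCJ.
rewrite mulrN subrr addr0 [X in _ - X]mulrC dotCE subr_ge0.
rewrite -[dotC z y]dotCJ -normCK -[`|_|]/((Normc.normc _)%:C).
by rewrite -rmorphXn lecR.
Qed.

(** * Unitary, diagonal and semidefinite matrices *)

Lemma unitary_isometry n (P : 'M[K[i]]_n) x :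
  P \is unitarymx -> vec_norm (P *m x) = vec_norm x.
Proof.
move=> Pu; apply: vec_norm_dotC; rewrite dotC_adjl mulmxA.
by rewrite -invmx_unitary // mulVmx ?mul1mx // unitarymx_unit.
Qed.

Lemma dotC_diag n (d : 'rV[K[i]]_n) x :
  dotC x (diag_mx d *m x) = \sum_i d 0 i * (Normc.normc (x i 0) ^+ 2)%:C.
Proof.
rewrite /dotC mxE; apply: eq_bigr => i _.
rewrite mul_diag_mx 3!mxE mulrCA; congr (_ * _).
by rewrite rmorphXn /= mulrC -normCK; congr (_ ^+ 2).
Qed.

Lemma possemidefP n (A : 'M[K[i]]_n) :
  possemidef A <-> Defs.hermitian A /\ forall x, 0 <= dotC x (A *m x).
Proof.
by split=> -[hA pA]; split=> // x; move: (pA x); rewrite /dotC mulmxA.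
Qed.

Lemma dotC_hermitian n (A : 'M[K[i]]_n) x y :
  Defs.hermitian A -> dotC (A *m x) y = dotC x (A *m y).
Proof. by move=> hA; rewrite dotC_adjl hA. Qed.

(** If [z = A *m y] were nonzero, moving from [y] a little in the direction [- z] would make the
    form negative: at [y - t z] it equals t^2 q - 2 t p, with p = |z|^2 and q = z^* A z. *)
Lemma possemidef_ker n (A : 'M[K[i]]_n) y :
  possemidef A -> dotC y (A *m y) = 0 -> A *m y = 0.
Proof.
move=> /possemidefP[hA pA] Ay0; set z := A *m y in Ay0 *; apply: dotC_eq0.
have := pA z; set q := dotC z (A *m z) => q0.
have qE : (complex.Re q)%:C = q by rewrite RRe_real // ger0_real.
move: q0; rewrite -qE ler0c => q0.
rewrite dotCE; set p := vec_norm z ^+ 2.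
have p0 : 0 <= p by rewrite sqr_ge0.
(* The added 1 keeps the denominator positive when q = 0. Since t q = p - t, the form becomes - t^2
   - t p, whose nonnegativity forces t = 0 and then p = 0. *)
pose t := p / (complex.Re q + 1).
have q1 : 0 < complex.Re q + 1 by rewrite ltr_wpDl.
have t0 : 0 <= t by rewrite divr_ge0 // ltW.
have := pA (y - t%:C *: z).
rewrite mulmxBr -scalemxAr !(dotCDr, dotCDl, dotCNr, dotCNl, dotCZl, dotCZr).
rewrite -/z Ay0 -[dotC y _](dotC_hermitian _ _ hA) -/z -/q -qE dotCE -/p.
rewrite (conjc_real t : Num.conj _ = _) lecE /= => /andP[_ ht].
have tE : t * complex.Re q = p - t.
  by rewrite /t; field; rewrite gt_eqF.
have : t * t <= - (t * p).
  have : t * (t * complex.Re q) = t * (p - t) by rewrite tE.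
  lra.
have tp : 0 <= t * p by rewrite mulr_ge0.
move=> tt; have t00 : t = 0 by apply/eqP; rewrite -sqrf_eq0 expr2 eq_le; nra.
by move: tE; rewrite t00 mul0r subr0 => <-.
Qed.

(** * Eigenvalues and the Rayleigh bound *)

Lemma eigenvalue_ge0 n (A : 'M[K[i]]_n) z :
  possemidef A -> eigenvalue A z -> 0 <= z.
Proof.
move=> /possemidefP[_ pA] /eigenvalueP[v vA v0].
have x0 : v^t* != 0 by rewrite adjmx_eq0.
have := pA (v^t*); rewrite /dotC trmxCK mulmxA vA -scalemxAl mxE.
rewrite -[X in X *m _]trmxCK pmulr_lge0 // lt_def dotC_ge0 andbT.
by apply: contra_neq x0; exact: dotC_eq0.
Qed.

(** From A = P^-1 D P, the rows of P are left eigenvectors, matching the row convention of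
    [eigenvalue]; they are nonzero because P is invertible. *)
Lemma spectrum_spectral_diag n (A : 'M[K[i]]_n) i :
  Defs.hermitian A -> eigenvalue A (spectral_diag A 0 i).
Proof.
move=> hA; have nA : A \is normalmx by apply/normalmxP; rewrite hA.
set P := spectralmx A; apply/eigenvalueP; exists (row i P).
  rewrite -row_mul {1}(orthomx_spectralP nA) -/P !mulmxA.
  rewrite mulmxV ?spectral_unit // mul1mx row_mul row_diag_mx.
  by rewrite -scalemxAl -rowE.
apply: contraNneq (oner_neq0 K[i]) => Pi0.
have : row i P *m invmx P = 0 by rewrite Pi0 mul0mx.
rewrite rowE mulmxK ?spectral_unit // => /matrixP/(_ 0 i).
by rewrite !mxE !eqxx => /eqP.
Qed.

Lemma lambda_min_ge0 n (A : 'M[K[i]]_n.+1) : possemidef A -> 0 <= lambda_min A.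
Proof.
move=> pA; apply: lb_le_inf => [|a /(eigenvalue_ge0 pA)]; last by rewrite ler0c.
have eA := spectrum_spectral_diag 0 pA.1.
exists (complex.Re (spectral_diag A 0 0)).
by rewrite /= RRe_real // ger0_real // (eigenvalue_ge0 pA).
Qed.

(** In spectral coordinates the form is a weighted mean of the eigenvalues, with weights |(P y)_i|^2
    summing to 1. Semidefiniteness makes the eigenvalues real and bounds them below by 0, so that
    [inf] lies below each of them. *)
Lemma lambda_min_le n (A : 'M[K[i]]_n) y :
  possemidef A -> vec_norm y = 1 -> (lambda_min A)%:C <= dotC y (A *m y).
Proof.
move=> pA y1; have hA := pA.1.
have nA : A \is normalmx by apply/normalmxP; rewrite hA.
set P := spectralmx A; have Pu : P \is unitarymx := spectral_unitarymx A.
have Ay : A *m y = P^t* *m (diag_mx (spectral_diag A) *m (P *m y)).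
  by rewrite [in LHS](orthomx_spectralP nA) invmx_unitary // !mulmxA.
rewrite Ay -dotC_adjl.
have -> : (lambda_min A)%:C =
    \sum_i (lambda_min A)%:C * (Normc.normc ((P *m y) i 0) ^+ 2)%:C.
  rewrite -mulr_sumr -rmorph_sum /= -sqr_vec_norm unitary_isometry //.
  by rewrite y1 expr1n mulr1.
rewrite dotC_diag; apply: ler_sum => i _.
rewrite ler_wpM2r ?ler0c ?sqr_ge0 //.
have ei := spectrum_spectral_diag i hA.
have si : (complex.Re (spectral_diag A 0 i))%:C = spectral_diag A 0 i.
  by rewrite RRe_real // ger0_real // (eigenvalue_ge0 pA).
rewrite -si lecR; apply: ge_inf; last by rewrite /= /spectrum /= si.
by exists 0 => a /(eigenvalue_ge0 pA); rewrite ler0c.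
Qed.

(** * Structured matrices mapping one vector to another *)

(* H is |h| times the Householder reflection exchanging y and h / |h|. *)
Lemma hermitian_transport n (y h : 'cV[K[i]]_n) :
  vec_norm y = 1 -> dotC h y = dotC y h ->
  exists H : 'M_n, [/\ Defs.hermitian H, H *m y = h &
    forall x, vec_norm (H *m x) = vec_norm h * vec_norm x].
Proof.
move=> y1 hy; set c := vec_norm h.
have yy : dotC y y = 1 by rewrite dotCE y1 expr1n.
have hh : dotC h h = c%:C * c%:C by rewrite dotCE expr2 rmorphM.
have cJ : Num.conj c%:C = c%:C by exact: conjc_real.
have isom (H : 'M_n) :
    (forall x, dotC (H *m x) (H *m x) = c%:C * c%:C * dotC x x) ->
    forall x, vec_norm (H *m x) = c * vec_norm x.
  move=> HH x; rewrite -[c in RHS]ger0_norm ?vec_norm_ge0 // -sqrtr_sqr.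
  have -> : Num.sqrt (c ^+ 2) = Normc.normc c%:C by rewrite /= expr0n addr0.
  rewrite -vec_normZ; apply: vec_norm_dotC.
  by rewrite HH dotCZl dotCZr cJ mulrA.
pose u := c%:C *: y - h; pose s := dotC u u.
have uy : dotC u y = c%:C - dotC y h.
  by rewrite dotCDl dotCNl dotCZl cJ yy mulr1 hy.
(* This uses |h| = c |y| and the reality of y^* h; it is what makes the reflection along u send y to
   h / c. *)
have sE : s = 2 * c%:C * dotC u y.
  rewrite /s {2}/u dotCDr dotCNr dotCZr uy dotCDl dotCNl dotCZl cJ hh; ring.
(* If u = 0 there is no direction to reflect along, but then h = c y and the scalar matrix c
   suffices. *)
have [u0|un0] := eqVneq u 0.
  exists (c%:C%:M); split.
  - by rewrite /Defs.hermitian adj_scalar_mx cJ.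
  - by rewrite mul_scalar_mx; apply/subr0_eq.
  - by apply: isom => x; rewrite mul_scalar_mx dotCZl dotCZr cJ mulrA.
have s0 : s != 0 by apply: contra_neq un0; exact: dotC_eq0.
have sJ : Num.conj s = s by rewrite /s dotCJ.
(* With this k, the matrix c I - k u u^* is c (I - 2 u u^* / |u|^2). *)
pose k := 2 * c%:C / s.
have kJ : Num.conj k = k.
  by rewrite /k rmorphM fmorphV rmorphM /= sJ cJ rmorph_nat.
have ks : k * s = 2 * c%:C by rewrite /k divfK.
pose H := c%:C%:M - k *: (u *m u^t*).
have HE x : H *m x = c%:C *: x - (k * dotC u x) *: u.
  by rewrite mulmxBl mul_scalar_mx -scalemxAl mul_rank1 scalerA.
exists H; split.
- rewrite /Defs.hermitian adjmxD adjmxN adjmxZ adj_scalar_mx cJ kJ adjmxM.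
  by rewrite trmxCK.
- have kuy : k * dotC u y = 1.
    by apply: (mulfI s0); rewrite mulrA [s * k]mulrC ks -sE mulr1.
  by rewrite HE kuy scale1r opprB addrC subrK.
clearbody u; apply: isom => x; rewrite HE.
rewrite !(dotCDr, dotCDl, dotCNr, dotCNl, dotCZl, dotCZr) -/s rmorphM /= cJ kJ.
rewrite dotCJ.
have kks : k * k * s = k * (2 * c%:C) by rewrite -mulrA ks.
(* All terms other than c^2 |x|^2 carry the factor k^2 s - 2 c k, which vanishes by the choice of
   k. *)
transitivity (c%:C * c%:C * dotC x x +
  dotC u x * dotC x u * (k * k * s - k * (2 * c%:C))).
  by rewrite /=; ring.
by rewrite kks subrr mulr0 addr0.
Qed.

(** Multiplication by i exchanges hermitian and skew-hermitian matrices: take i H, where H is a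
    hermitian matrix sending y to - i w. *)
Lemma skew_hermitian_transport n (y w : 'cV[K[i]]_n) :
  vec_norm y = 1 -> dotC w y = - dotC y w ->
  exists E : 'M_n, [/\ skew_hermitian E, E *m y = w &
    forall x, vec_norm (E *m x) = vec_norm w * vec_norm x].
Proof.
move=> y1 wy; pose j : K[i] := 0 +i* 1.
have jJ : Num.conj j = - j.
  by apply/eqP; rewrite eq_complex /= oppr0 !eqxx.
have jj : j * j = -1 by exact: (sqr_i K).
have nj x : vec_norm (j *: x) = vec_norm (x : 'cV_n).
  by rewrite vec_normZ /= expr0n expr1n add0r sqrtr1 mul1r.
have [|H [hH Hy Hn]] := @hermitian_transport n y (- j *: w) y1.
  by rewrite dotCZl dotCZr rmorphN /= jJ wy opprK mulrN mulNr.
exists (j *: H); split.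
- by rewrite /skew_hermitian adjmxZ hH jJ scaleNr.
- by rewrite -scalemxAl Hy scalerA mulrN jj opprK scale1r.
- move=> x; rewrite -scalemxAl nj Hn; congr (_ * _).
  by rewrite scaleNr -scalerN nj -scaleN1r vec_normZ normcN Normc.normc1 mul1r.
Qed.

(** * The smallest eigenvalue of R and its eigenvector *)

Section SpectralDecomposition.
Context {n : nat} {R V : 'M[K[i]]_n.+1} {d : 'rV[K]_n.+1}.
Hypothesis hV : V \is unitarymx.
Hypothesis hVD : V^t* *m R *m V = diag_mx (map_mx (real_complex K) d).
Hypothesis hd : forall i j : 'I_n.+1, (i <= j)%N -> d 0 j <= d 0 i.
Hypothesis hd0 : 0 <= d 0 ord_max.

Lemma spectral_decomposition :
  R = V *m diag_mx (map_mx (real_complex K) d) *m V^t*.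
Proof.
rewrite -hVD !mulmxA mulmxtVK // -invmx_unitary // mulmxV ?mul1mx //.
exact: unitarymx_unit.
Qed.

(** In the eigenbasis |R y|^2 is the sum of d_i^2 |z_i|^2 with |z| = 1, and d_i^2 >= d_n^2 because
    d_i >= d_n >= 0. *)
Lemma min_eigenvalue_le_vec_norm y :
  vec_norm y = 1 -> d 0 ord_max <= vec_norm (R *m y).
Proof.
move=> y1; rewrite spectral_decomposition -!mulmxA unitary_isometry //.
set z := V^t* *m y.
have z1 : vec_norm z = 1 by rewrite unitary_isometry ?trmxC_unitary.
clearbody z; rewrite -(@ler_pXn2r _ 2) ?nnegrE ?vec_norm_ge0 //.
rewrite -[_ ^+ 2]mulr1 -{1}(expr1n _ 2) -z1 !sqr_vec_norm mulr_sumr.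
apply: ler_sum => i _; rewrite mul_diag_mx 2!mxE Normc.normcM exprMn.
rewrite ler_wpM2r ?sqr_ge0 //= expr0n addr0 sqr_sqrtr ?sqr_ge0 //.
have di : d 0 ord_max <= d 0 i by rewrite hd // -ltnS.
by rewrite ler_pXn2r ?nnegrE // (le_trans hd0).
Qed.

Lemma mul_last_eigenvector :
  let y : 'cV_n.+1 := V *m delta_mx ord_max 0 in
  R *m y = (d 0 ord_max)%:C *: y.
Proof.
rewrite /= spectral_decomposition -!mulmxA -invmx_unitary //.
rewrite mulKmx ?unitarymx_unit // scalemxAr.
congr (_ *m _); apply/matrixP => i j; rewrite mul_diag_mx !mxE.
by case: eqP => [->|] //; rewrite !mulr0.
Qed.

Lemma vec_norm_last_eigenvector :
  vec_norm (V *m delta_mx ord_max 0 : 'cV_n.+1) = 1.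
Proof.
rewrite unitary_isometry //; set e := delta_mx _ _.
have : vec_norm e ^+ 2 = 1.
  rewrite sqr_vec_norm (bigD1 ord_max) //= big1 => [|i ni].
    by rewrite mxE !eqxx Normc.normc1 expr1n addr0.
  by rewrite mxE (negPf ni) Normc.normc0 expr0n.
by move=> /eqP; rewrite sqrp_eq1 ?vec_norm_ge0 // => /eqP.
Qed.

(** In the coordinates z = V^* x, the subtracted matrix removes exactly the last term from the sum
    of d_i |z_i|^2. This is the condition R + DR >= 0 for the constructed DR. *)
Lemma possemidef_deflation :
  let y : 'cV_n.+1 := V *m delta_mx ord_max 0 in
  possemidef R -> possemidef (R - (d 0 ord_max)%:C *: (y *m y^t*)).
Proof.
move=> y [hR _]; apply/possemidefP; split.
  rewrite /Defs.hermitian adjmxD adjmxN adjmxZ adjmxM trmxCK hR.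
  by rewrite (conjc_real _ : Num.conj _ = _).
move=> x; rewrite mulmxBl -scalemxAl mul_rank1 dotCDr dotCNr !dotCZr.
set z := V^t* *m x.
have yx : dotC y x = z ord_max 0.
  rewrite dotC_adjl -/z; clearbody z; rewrite /dotC mxE (bigD1 ord_max) //=.
  rewrite big1 => [|i ni]; last by rewrite !mxE (negPf ni) conjC0 mul0r.
  by rewrite !mxE !eqxx conjC1 mul1r addr0.
rewrite [X in dotC x (X *m x)]spectral_decomposition -!mulmxA dotC_adjr -/z.
clearbody z.
rewrite dotC_diag (bigD1 ord_max) //= -[dotC x y]dotCJ yx mxE.
rewrite -normCK (_ : `|z ord_max 0| = (Normc.normc (z ord_max 0))%:C) //.
rewrite -rmorphXn /=.
rewrite addrAC subrr add0r sumr_ge0 // => i _.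
rewrite mxE -rmorphM ler0c mulr_ge0 ?sqr_ge0 // (le_trans hd0) //.
by rewrite hd // -ltnS.
Qed.
End SpectralDecomposition.

(** * Skew-hermitian forms, Gram matrices and the pencil *)

Lemma skew_hermitian_form n (E : 'M[K[i]]_n) x y :
  skew_hermitian E -> dotC (E *m x) y = - dotC x (E *m y).
Proof. by move=> hE; rewrite dotC_adjl hE mulNmx dotCNr. Qed.

Lemma possemidef_gram m n (S : 'M[K[i]]_(m, n)) : possemidef (S^t* *m S).
Proof.
apply/possemidefP; split; first by rewrite /Defs.hermitian adjmxM trmxCK.
by move=> x; rewrite -mulmxA -dotC_adjl dotC_ge0.
Qed.

Lemma posdef_unitmx n (Q : 'M[K[i]]_n) : posdef Q -> Q \in unitmx.
Proof.
move=> [hQ pQ]; rewrite -row_free_unit -kermx_eq0; apply/eqP/row_matrixP => i.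
set v := row i (kermx Q); rewrite row0; apply/eqP; apply/negPn/negP => v0.
have vQ : v *m Q = 0 by rewrite /v -row_mul mulmx_ker row0.
have x0 : v^t* != 0 by rewrite adjmx_eq0.
by have := pQ _ x0; rewrite trmxCK vQ mul0mx mxE ltxx.
Qed.

Lemma pair_norm_ge0 n (D : 'M[K[i]]_n * 'M[K[i]]_n) : 0 <= pair_norm D.
Proof. exact: sqrtr_ge0. Qed.

Lemma sqr_pair_norm n (D : 'M[K[i]]_n * 'M[K[i]]_n) :
  pair_norm D ^+ 2 = spectral_norm D.1 ^+ 2 + spectral_norm D.2 ^+ 2.
Proof. by rewrite sqr_sqrtr // addr_ge0 // sqr_ge0. Qed.

(** The S(w) of the overview, expanded so that its skew-hermitian structure is visible;
    [skew_pencilE] recovers the product form. *)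
Definition skew_pencil n (J Q : 'M[K[i]]_n) (w : K) : 'M[K[i]]_n :=
  (w *i) *: invmx Q - J.

(** * Lower and upper bounds at a fixed frequency w *)

Section Radius.
Context {n : nat} {J R Q V : 'M[K[i]]_n.+1} {d : 'rV[K]_n.+1}.
Hypothesis hJ : skew_hermitian J.
Hypothesis hR : possemidef R.
Hypothesis hQ : posdef Q.
Hypothesis hV : V \is unitarymx.
Hypothesis hVD : V^t* *m R *m V = diag_mx (map_mx (real_complex K) d).
Hypothesis hd : forall i j : 'I_n.+1, (i <= j)%N -> d 0 j <= d 0 i.
Hypothesis hd0 : 0 <= d 0 ord_max.

Lemma skew_pencilE w : ((w *i)%:M - J *m Q) *m invmx Q = skew_pencil J Q w.
Proof.
by rewrite mulmxBl mul_scalar_mx -mulmxA mulmxV ?mulmx1 // posdef_unitmx.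
Qed.

Lemma conj_imaginary w : Num.conj (w *i) = - (w *i) :> K[i].
Proof. by apply/eqP; rewrite eq_complex /= oppr0 !eqxx. Qed.

Lemma skew_hermitian_pencil w : skew_hermitian (skew_pencil J Q w).
Proof.
rewrite /skew_hermitian adjmxD adjmxN adjmxZ conj_imaginary adj_invmx hQ.1 hJ.
by rewrite scaleNr opprB addrC opprK.
Qed.

Lemma gram_pencil w :
  invmx Q *m ((w *i)%:M - J *m Q)^t* *m ((w *i)%:M - J *m Q) *m invmx Q
  = (skew_pencil J Q w)^t* *m skew_pencil J Q w.
Proof.
by rewrite -skew_pencilE adjmxM adj_invmx hQ.1 !mulmxA.
Qed.

(* [eigenvalue] provides a row eigenvector u; its adjoint y = u^* satisfies
   S y = (DJ + (R + DR)) y with the same sign of DJ as for a column eigenvector,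
   because J + DJ, R + DR and Q^-1 are respectively skew-hermitian,
   hermitian and hermitian. *)
Lemma pair_norm_destabilizing_ge (D : 'M[K[i]]_n.+1 * 'M[K[i]]_n.+1) w :
  Sd J R D -> eigenvalue ((J + D.1 - (R + D.2)) *m Q) (w *i) ->
  d 0 ord_max ^+ 2 + lambda_min ((skew_pencil J Q w)^t* *m skew_pencil J Q w)
    <= pair_norm D ^+ 2.
Proof.
case: D => E F [/= hE [hF _] hRF] /eigenvalueP[u uA u0].
set S := skew_pencil J Q w.
have x0 : u^t* != 0 by rewrite adjmx_eq0.
have Sx : S *m u^t* = E *m u^t* + (R + F) *m u^t*.
  have := congr1 (fun M => (M *m invmx Q)^t*) uA.
  rewrite -!mulmxA mulmxV ?posdef_unitmx // mulmx1 -scalemxAl adjmxM adjmxZ.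
  rewrite adjmxM adj_invmx hQ.1 conj_imaginary adjmxD adjmxD adjmxN.
  rewrite hJ hE hRF.1 => /(congr1 -%R); rewrite scaleNr opprK => h.
  rewrite /S mulmxBl -scalemxAl -h mulmxBl mulmxDl !mulNmx mulmxDl.
  by rewrite !opprD !opprK addrAC [J *m _ + _]addrC addrK.
pose y := (vec_norm (u^t*))^-1%:C *: u^t*.
have y1 : vec_norm y = 1 by exact: vec_norm_normalize.
have Sy : S *m y = E *m y + (R + F) *m y.
  by rewrite -!scalemxAr Sx scalerDr.
clearbody y.
(* The skew-hermitian parts cancel, leaving the form of R + F at y equal to its own negative. *)
have RFy : (R + F) *m y = 0.
  apply: (possemidef_ker hRF).
  have : dotC (S *m y) y = - dotC y (S *m y).
    exact: skew_hermitian_form (skew_hermitian_pencil w).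
  rewrite Sy dotCDl dotCDr (skew_hermitian_form _ _ hE) opprD => /addrI.
  rewrite (dotC_hermitian _ _ hRF.1) => /eqP.
  by rewrite -subr_eq0 opprK -mulr2n mulrn_eq0 => /eqP.
have Fy : vec_norm (F *m y) = vec_norm (R *m y).
  move: RFy; rewrite mulmxDl addrC => /addr0_eq <-.
  by rewrite -scaleN1r vec_normZ normcN Normc.normc1 mul1r.
rewrite sqr_pair_norm /= addrC lerD //; last first.
  rewrite ler_pXn2r ?nnegrE //; last first.
    by apply: le_trans (spectral_norm_ge F y1); exact: vec_norm_ge0.
  apply: le_trans (spectral_norm_ge F y1); rewrite Fy.
  exact: (min_eigenvalue_le_vec_norm hV hVD hd hd0).
(* The remaining chain is lambda_min(S^* S) <= |S y|^2 = |E y|^2 <= |E|^2. *)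
apply: (@le_trans _ _ (vec_norm (S *m y) ^+ 2)).
  rewrite -lecR -dotCE dotC_adjl mulmxA.
  exact: (lambda_min_le (possemidef_gram _)).
rewrite Sy RFy addr0 ler_pXn2r ?nnegrE ?vec_norm_ge0 ?spectral_norm_ge //.
by apply: le_trans (spectral_norm_ge E y1); exact: vec_norm_ge0.
Qed.

Lemma exists_destabilizing w :
  let y : 'cV_n.+1 := V *m delta_mx ord_max 0 in
  exists D, [/\ Sd J R D,
    eigenvalue ((J + D.1 - (R + D.2)) *m Q) (w *i) &
    pair_norm D ^+ 2 =
      d 0 ord_max ^+ 2 + vec_norm (skew_pencil J Q w *m y) ^+ 2].
Proof.
move=> y; have y1 : vec_norm y = 1 by apply: vec_norm_last_eigenvector.
have yy : dotC y y = 1 by rewrite dotCE y1 expr1n.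
have Ry : R *m y = (d 0 ord_max)%:C *: y by exact: mul_last_eigenvector hV hVD.
have hRyy : possemidef (R - (d 0 ord_max)%:C *: (y *m y^t*)).
  exact: possemidef_deflation.
clearbody y; have [E [hE Ey En]] := skew_hermitian_transport y1
  (skew_hermitian_form y y (skew_hermitian_pencil w)).
pose F := - ((d 0 ord_max)%:C *: (y *m y^t*)).
have hF : Defs.hermitian F.
  rewrite /Defs.hermitian adjmxN adjmxZ adjmxM trmxCK.
  by rewrite (conjc_real _ : Num.conj _ = _).
have FE x : F *m x = (- (d 0 ord_max)%:C * dotC y x) *: y.
  by rewrite mulNmx -scalemxAl mul_rank1 scalerA mulNr scaleNr.
have nF x : vec_norm (F *m x) = d 0 ord_max * Normc.normc (dotC y x).
  rewrite FE vec_normZ y1 mulr1 Normc.normcM normcN /= expr0n addr0 sqrtr_sqr.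
  by rewrite ger0_norm.
have hRF : possemidef (R + F) := hRyy.
have RFy : (R + F) *m y = 0.
  rewrite mulmxDl Ry FE yy mulr1 scaleNr.
  by rewrite subrr.
exists (E, F); split.
- split => //=; split => // x.
  rewrite -mulmxA -[X in X <= 0]/(dotC x (F *m x)) FE dotCZr -dotCJ.
  rewrite !mulNr oppr_le0 -mulrA mulr_ge0 ?ler0c //.
  by rewrite mulrC mul_conjC_ge0.
(* The left eigenvector is y^*: it annihilates R + F, and E y = S y gives y^* E = y^* S by skewness,
   so y^* (J + E) = i w y^* Q^-1. *)
- apply/eigenvalueP; exists (y^t*); last first.
    apply: contra_eq_neq yy => y0.
    by rewrite /dotC y0 mul0mx mxE eq_sym oner_eq0.
  have yRF : y^t* *m (R + F) = 0.
    by rewrite -[R + F]trmxCK -adjmxM hRF.1 RFy trmx0 map_mx0.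
  have yE : y^t* *m E = y^t* *m skew_pencil J Q w.
    have adjE G : skew_hermitian G -> y^t* *m G = - (G *m y)^t*.
      by move=> hG; rewrite adjmxM hG mulmxN opprK.
    by rewrite (adjE _ hE) (adjE _ (skew_hermitian_pencil w)) Ey.
  rewrite mulmxA mulmxBr yRF subr0 mulmxDr yE -mulmxDr addrC subrK.
  by rewrite -scalemxAr -scalemxAl mulmxKV ?posdef_unitmx.
rewrite sqr_pair_norm /= addrC.
(* Both norms are attained at y: E is a multiple of an isometry, and F has rank one along y, so
   Cauchy-Schwarz applies. *)
rewrite (spectral_norm_eq (A := E) y1) => [|z z1]; last by rewrite !En y1 z1.
rewrite (spectral_norm_eq (A := F) y1) => [|z z1].
  by rewrite En nF yy Normc.normc1 y1 !mulr1.
rewrite !nF yy Normc.normc1 ler_wpM2l //.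
by rewrite (le_trans (normc_dotC_le z y1)) // z1.
Qed.
End Radius.

End ComplexMatrices.

(** * Passage to infima over w and over all perturbations *)

Theorem corollary3p3 (K : realType) (n : nat)
    (J R Q V : 'M[K[i]]_n.+1) (d : 'rV[K]_n.+1)
    (hJ : skew_hermitian J) (hR : possemidef R) (hQ : posdef Q)
    (hstab : asymptotically_stable ((J - R) *m Q))
    (hV : V \is unitarymx)
    (hVD : V^t* *m R *m V = diag_mx (map_mx (real_complex K) d))
    (hd_decr : forall i j : 'I_n.+1, (i <= j)%N -> d 0 j <= d 0 i)
    (hd_ge0 : 0 <= d 0 ord_max) :
  let M (w : K) : 'M[K[i]]_n.+1 := (w *i)%:M - J *m Q in
  let xhat : 'cV[K[i]]_n.+1 := invmx Q *m V *m delta_mx ord_max 0 in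
  (((d 0 ord_max) ^+ 2)%:E +
     ereal_inf [set (lambda_min (invmx Q *m (M w)^t* *m M w *m invmx Q))%:E
               | w in [set: K]]
   <= radius_Sd J R Q ^+ 2)%E /\
  (radius_Sd J R Q ^+ 2
   <= ((d 0 ord_max) ^+ 2)%:E +
     ereal_inf [set (vec_norm (M w *m xhat) ^+ 2 / vec_norm (Q *m xhat) ^+ 2)%:E
               | w in [set: K]])%E.
Proof.
move=> M xhat.
pose y : 'cV[K[i]]_n.+1 := V *m delta_mx ord_max 0.
have Qxhat : Q *m xhat = y by rewrite !mulmxA mulmxV ?mul1mx // posdef_unitmx.
have Mxhat w : M w *m xhat = skew_pencil J Q w *m y :> 'cV_n.+1.
  by rewrite -(skew_pencilE hQ) /xhat !mulmxA.
have r_ge0 : (0 <= radius_Sd J R Q)%E.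
  by apply: le_ereal_inf_tmp => _ [D _ <-]; rewrite lee_fin pair_norm_ge0.
have r_le w : exists2 s : K,
    s ^+ 2 = d 0 ord_max ^+ 2 + vec_norm (M w *m xhat) ^+ 2 &
    0 <= s /\ (radius_Sd J R Q <= s%:E)%E.
  have [D [DS Dw Dn]] := exists_destabilizing hJ hR hQ hV hVD hd_decr hd_ge0 w.
  exists (pair_norm D); first by rewrite Dn Mxhat.
  split; first exact: pair_norm_ge0.
  by apply: ereal_inf_lbound; exists D => //; split=> //; exists (w *i).
(* The destabilizing pair at w = 0 already makes the radius finite, so the estimates can be carried
   out in K. *)
have /fineK rE : radius_Sd J R Q \is a fin_num.
  have [s _ [_ rs]] := r_le 0.
  by rewrite ge0_fin_numE // (le_lt_trans rs) ?ltry.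
move: r_ge0 r_le; rewrite -rE; set r := fine _; rewrite lee_fin => r_ge0 r_le.
rewrite -EFin_expe; split; last first.
  rewrite -leeBlDl //; apply: le_ereal_inf_tmp => _ [w _ <-].
  rewrite Qxhat vec_norm_last_eigenvector // expr1n divr1 -EFinB lee_fin.
  have [s sE [s_ge0]] := r_le w; rewrite lee_fin => rs.
  by rewrite lerBlDl -sE ler_pXn2r ?nnegrE.
pose G w := (skew_pencil J Q w)^t* *m skew_pencil J Q w.
have GE w : invmx Q *m (M w)^t* *m M w *m invmx Q = G w by exact: gram_pencil.
have -> : [set (lambda_min (invmx Q *m (M w)^t* *m M w *m invmx Q))%:E
          | w in [set: K]] = [set (lambda_min (G w))%:E | w in [set: K]].
  by apply: eq_imagel => w _; rewrite GE.
set L := [set _ | w in _].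
have L_ge0 : (0 <= ereal_inf L)%E.
  apply: le_ereal_inf_tmp => _ [w _ <-].
  by rewrite lee_fin; apply: lambda_min_ge0; exact: possemidef_gram.
have L_le w : (ereal_inf L <= (lambda_min (G w))%:E)%E.
  by apply: ereal_inf_lbound; exists w.
have /fineK LE : ereal_inf L \is a fin_num.
  by rewrite ge0_fin_numE // (le_lt_trans (L_le 0)) ?ltry.
move: L_ge0 L_le; rewrite -LE; set l := fine _; rewrite lee_fin => l_ge0 L_le.
rewrite -EFinD lee_fin.
have e_ge0 : 0 <= d 0 ord_max ^+ 2 + l by rewrite addr_ge0 // sqr_ge0.
(* The radius is an infimum of norms, not of squares: the square root of the bound is compared with
   each [pair_norm], and squaring again reduces to the estimate at one frequency. *)
rewrite -(sqr_sqrtr e_ge0) ler_pXn2r ?nnegrE ?sqrtr_ge0 // -lee_fin rE.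
apply: le_ereal_inf_tmp => _ [D [DS [[a b] [/= Dz a0]]] <-].
(* The eigenvalue a + i b has a = 0, so the frequency is w = b. *)
rewrite /imaginary_axis /= in a0; rewrite a0 in Dz.
rewrite lee_fin -(@ler_pXn2r _ 2) ?nnegrE ?sqrtr_ge0 ?pair_norm_ge0 //.
rewrite sqr_sqrtr //.
apply: le_trans (pair_norm_destabilizing_ge hJ hQ hV hVD hd_decr hd_ge0 DS Dz).
rewrite lerD2l -lee_fin; exact: L_le.
Qed.
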